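(* Let $S\neq\mathbb{N}$ be a numerical semigroup, and write $S=\{0=s_0<s_1<\dots<s_{\mathrm{n}(S)-1}<s_{\mathrm{n}(S)}=\mathrm{F}(S)+1,\rightarrow\}$. Then $S$ is an A-semigroup if and only if $(s_{\mathrm{n}(S)}-s_{\mathrm{n}(S)-1},\,s_{\mathrm{n}(S)-1}-s_{\mathrm{n}(S)-2},\,\dots,\,s_1-s_0)$ is an A-sequence.
   Context: $\mathbb{N}$ denotes the set of nonnegative integers. A numerical semigroup is a subset $S\subseteq\mathbb{N}$ that contains $0$, is closed under addition, and has finite complement in $\mathbb{N}$. The Frobenius number $\mathrm{F}(S)$ is the greatest integer not in $S$, and $\mathrm{n}(S)$ is the number of elements $s\in S$ with $s<\mathrm{F}(S)$. The symbol $\rightarrow$ means that all integers larger than the last listed one belong to the set; thus $s_0<\dots<s_{\mathrm{n}(S)-1}$ are the elements of $S$ smaller than $\mathrm{F}(S)$, in increasing order. An A-semigroup (Arf numerical semigroup) is a numerical semigroup $S$ such that $x+y-z\in S$ for all $x,y,z\in S$ with $x\ge y\ge z$. For $n\in\mathbb{N}\setminus\{0\}$, an $n$-sequence of integers $(x_1,\dots,x_n)$ is an A-sequence if 1) $2\le x_1\le x_2\le\dots\le x_n$; and 2) $x_{i+1}\in\{x_i,\,x_i+x_{i-1},\,\dots,\,x_i+x_{i-1}+\dots+x_1,\rightarrow\}$ for all $i\in\{1,\dots,n-1\}$. *)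

(* Defs.v *)
From mathcomp Require Import all_boot all_order all_algebra finmap.
From mathcomp Require Import boolp classical_sets cardinality.

Set Implicit Arguments.
Unset Strict Implicit.
Unset Printing Implicit Defensive.

Import Order.TTheory GRing.Theory Num.Theory.
Local Open Scope classical_set_scope.
Local Open Scope ring_scope.

Definition numerical_semigroup (S : set nat) : Prop :=
  [/\ S 0%N, (forall x y, S x -> S y -> S (x + y)%N) & finite_set (~` S)].

(* Meaningful for a numerical semigroup S <> setT, whose greatest missing
   integer is a natural number; the default value 0 is a dummy otherwise. *)
Definition frobenius_number (S : set nat) : nat :=
  xget 0%N [set m | ~ S m /\ forall k, ~ S k -> (k <= m)%N].

(* n(S) *)
Definition num_small (S : set nat) : nat :=
  #|` fset_set [set x | S x /\ (x < frobenius_number S)%N] |.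

(* Since y >= z, the truncated subtraction is the genuine one. *)
Definition A_semigroup (S : set nat) : Prop :=
  numerical_semigroup S /\
  forall x y z, S x -> S y -> S z -> (z <= y)%N -> (y <= x)%N ->
    S (x + y - z)%N.

(* The entry x_i of (x_1, ..., x_n) is x`_(i-1).  In the last clause, the left
   disjunct lists the sums x_i + ... + x_j with j <= i, and the right one is
   the arrow following x_i + ... + x_1. *)
Definition A_sequence (x : seq int) : Prop :=
  [/\ (0 < size x)%N,
      2 <= x`_0,
      (forall i, (i.+1 < size x)%N -> x`_i <= x`_i.+1) &
      forall i, (i.+1 < size x)%N ->
        (exists2 j, (j <= i)%N & x`_i.+1 = \sum_(j <= k < i.+1) x`_k) \/
        \sum_(0 <= k < i.+1) x`_k < x`_i.+1].

(* S = {0 = s_0 < s_1 < ... < s_n = F(S) + 1, ->} with n = n(S); the values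
   of s beyond n are irrelevant. *)
Definition enumerates (S : set nat) (s : nat -> nat) : Prop :=
  let n := num_small S in
  [/\ s 0%N = 0%N,
      (forall i, (i < n)%N -> (s i < s i.+1)%N),
      s n = (frobenius_number S).+1 &
      S = [set x | (exists2 i, (i <= n)%N & x = s i) \/ (s n < x)%N]].

Lemma frobenius_numberP (S : set nat) :
  numerical_semigroup S -> S <> setT ->
  ~ S (frobenius_number S) /\
  forall k, ~ S k -> (k <= frobenius_number S)%N.
Proof.
move=> [S0 _ /finite_seqP[l lE]] SN.
have inl k : ~ S k <-> k \in l.
  by have -> : (~ S k) = (~` S) k by []; rewrite lE.
have [k0 Sk0] : exists k, ~ S k.
  apply: contrapT => /forallNP h; apply: SN; apply/seteqP; split => // x _.
  by apply: contrapT; exact: h.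
have ex : exists m, m \in l by exists k0; apply/inl.
have bd m : m \in l -> (m <= \max_(i <- l) i)%N by move=> ml; apply: leq_bigmax_seq.
case: (ex_maxnP ex bd) => m ml mmax.
apply: (@xgetPex _ 0%N [set m | ~ S m /\ forall k, ~ S k -> (k <= m)%N]).
by exists m; split; [apply/inl | move=> k /inl; exact: mmax].
Qed.

Lemma enumerates_ex (S : set nat) :
  numerical_semigroup S -> S <> setT -> exists s, enumerates S s.
Proof.
move=> nS SN; have [SF Fmax] := frobenius_numberP nS SN.
have [S0 _ _] := nS; set F := frobenius_number S in SF Fmax *.
pose l := [seq x <- iota 0 F | `[< S x >]].
have lP x : x \in l <-> S x /\ (x < F)%N.
  rewrite mem_filter mem_iota add0n /=; split.
    by move=> /andP[/asboolP].
  by move=> [/asboolP -> ->].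
have ul : uniq l by rewrite filter_uniq ?iota_uniq.
have nE : num_small S = size l.
  rewrite /num_small -/F.
  have -> : [set x | S x /\ (x < F)%N] = [set` l].
    by apply/seteqP; split => x /lP.
  have -> : [set` l] = [set` [fset x in l]%fset].
    by apply/seteqP; split => x /=; rewrite inE.
  by rewrite set_fsetK card_fseq undup_id.
have sl : sorted ltn l by apply: sorted_filter; [exact: ltn_trans | exact: iota_ltn_sorted].
have F0 : (0 < F)%N by rewrite lt0n; apply/eqP => F0; apply: SF; rewrite F0.
exists (nth F.+1 l); rewrite /enumerates nE; split.
- by rewrite /l -(prednK F0) /= asboolT.
- move=> i il; case: (ltnP i.+1 (size l)) => h.
    by apply: (sorted_ltn_nth ltn_trans).
  rewrite (nth_default _ h).
  by have /lP[_ /ltnW] := mem_nth F.+1 il.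
- by rewrite nth_default.
- apply/seteqP; split => x /=; rewrite [nth _ _ (size l)]nth_default //.
    move=> Sx; case: (ltngtP x F) => [xF|xF|xF]; last by move: Sx; rewrite xF.
      left; exists (index x l); first exact: index_size.
      by rewrite nth_index //; apply/lP.
    move: xF; rewrite leq_eqVlt => /orP[/eqP <-|]; last by right.
    by left; exists (size l) => //; rewrite nth_default.
  have big y : (F < y)%N -> S y.
    by move=> Fy; apply: contrapT => /Fmax; rewrite leqNgt Fy.
  case=> [[i _ ->]|xF]; last by apply: big; exact: ltnW.
  case: (ltnP i (size l)) => h; first by have /lP[] := mem_nth F.+1 h.
  by rewrite nth_default //; apply: big.
Qed.

(* Main.v *)
Require Import Defs.
From mathcomp Require Import all_boot all_order all_algebra.
From mathcomp Require Import boolp classical_sets.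
From mathcomp Require Import zify.

Set Implicit Arguments.
Unset Strict Implicit.
Unset Printing Implicit Defensive.

Import GRing.Theory.
Local Open Scope classical_set_scope.
Local Open Scope ring_scope.

(** Write [n] for [num_small S].  Both sides of the equivalence say that [S]
    is closed under the consecutive steps
    [s_m, s_(m+1) |-> 2 s_(m+1) - s_m], for [m + 1 < n].

    Number the differences from 0, so that [x_i = s_(n-i) - s_(n-i-1)] for
    [i < n].  Then [x_j + ... + x_i = s_(n-j) - s_(n-i-1)] by telescoping.
    With [m + 1 = n - i - 1], the condition on [x_(i+1)] thus says that
    [s_(m+1) + (s_(m+1) - s_m)] is one of [s_(m+2), ..., s_n] or exceeds
    [s_n]; as this number is larger than [s_(m+1)], that amounts to its being
    in [S].  It also forces [x_i <= x_(i+1)], since [s_(m+2)] is the least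
    element of [S] above [s_(m+1)]; and [2 <= x_0] because [F(S)] is not
    in [S].  This is [A_sequence_gapsP].

    An A-semigroup is closed under these steps by definition (take
    [x = y = s_(m+1)] and [z = s_m]).  Conversely, let [S_c] be the set of
    the [t - s_c] for [t] in [S] with [t >= s_c]; the Arf property says that
    every [S_c] is closed under addition.  If [d = s_(c+1) - s_c], then
    [S_c = {0} U (d + S_(c+1))], so [S_c] inherits closure from [S_(c+1)] as
    soon as [d] is in [S_(c+1)], which is a consecutive step.  A descending
    induction from [S_n], which is the set of all natural numbers, concludes:
    this is [step_closed_add]. *)

(** * Enumerated semigroups *)

Lemma enum_lt (S : set nat) (s : nat -> nat) (i j : nat) :
  enumerates S s -> (i < j)%N -> (j <= num_small S)%N -> (s i < s j)%N.
Proof.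
case=> _ incr _ _; elim: j => // j IH; rewrite ltnS leq_eqVlt => ij jn.
have sj := incr _ jn.
by case/orP: ij => [/eqP -> //|ij]; apply: ltn_trans sj; apply: IH ij (ltnW jn).
Qed.

Lemma enum_mem (S : set nat) (s : nat -> nat) (i : nat) :
  enumerates S s -> (i <= num_small S)%N -> S (s i).
Proof. by case=> _ _ _ SE iln; rewrite SE /=; left; exists i. Qed.

Lemma enum_conductor (S : set nat) (s : nat -> nat) (x : nat) :
  enumerates S s -> (s (num_small S) <= x)%N -> S x.
Proof.
move=> es; rewrite leq_eqVlt => /orP[/eqP <-|nx]; first exact: (enum_mem es (leqnn _)).
by case: es => _ _ _ ->; right.
Qed.

Lemma enum_cases (S : set nat) (s : nat -> nat) (x : nat) :
  enumerates S s -> S x ->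
  (exists2 i, (i <= num_small S)%N & x = s i) \/ (s (num_small S) < x)%N.
Proof. by case=> _ _ _ {1}->. Qed.

Lemma enum_above (S : set nat) (s : nat -> nat) (x i : nat) :
  enumerates S s -> (i < num_small S)%N -> S x -> (s i < x)%N ->
  (exists2 j, (i < j <= num_small S)%N & x = s j) \/ (s (num_small S) < x)%N.
Proof.
move=> es iln /(enum_cases es)[[j jn xE]|]; last by right.
move=> six; left; exists j => //; rewrite jn andbT ltnNge.
apply/negP; rewrite leq_eqVlt => /orP[/eqP ji|ji].
  by move: six; rewrite xE ji ltnn.
by have := enum_lt es ji (ltnW iln); lia.
Qed.

Lemma enum_next_le (S : set nat) (s : nat -> nat) (x i : nat) :
  enumerates S s -> (i < num_small S)%N -> S x -> (s i < x)%N ->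
  (s i.+1 <= x)%N.
Proof.
have le j : enumerates S s -> (i < j)%N -> (j <= num_small S)%N ->
    (s i.+1 <= s j)%N.
  move=> es; rewrite leq_eqVlt => /orP[/eqP <- //|ij jn].
  by apply/ltnW/(enum_lt es).
move=> es iln Sx six; have [[j /andP[ij jn] ->]|nx] := enum_above es iln Sx six.
  exact: le.
by have := le _ es iln (leqnn _); lia.
Qed.

Lemma num_small_gt0 (S : set nat) (s : nat -> nat) :
  enumerates S s -> (0 < num_small S)%N.
Proof. by case=> s0 _ sn _; rewrite lt0n; apply/eqP => n0; move: sn; rewrite n0 s0. Qed.

(** * The Arf property from consecutive elements *)

Definition step_closed (S : set nat) (s : nat -> nat) : Prop :=
  forall m, (m.+1 < num_small S)%N -> S (2 * s m.+1 - s m)%N.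

(** Descending induction on [c], through
    [x + y - s_c = (x + y - s_(c+1)) + (2 s_(c+1) - s_c) - s_(c+1)],
    where the right-hand side uses the closure at [c + 1] twice. *)
Lemma step_closed_add (S : set nat) (s : nat -> nat) (c x y : nat) :
  enumerates S s -> step_closed S s -> (c <= num_small S)%N ->
  S x -> S y -> (s c <= x)%N -> (s c <= y)%N -> S (x + y - s c)%N.
Proof.
move=> es st cn; have [k kE] : exists k, (k + c = num_small S)%N.
  by exists (num_small S - c)%N; rewrite subnK.
elim: k c cn kE x y => [|k IH] c cn kE x y Sx Sy.
  move: kE; rewrite add0n => -> cx cy; apply: (enum_conductor es); lia.
have cltn : (c < num_small S)%N by lia.
rewrite leq_eqVlt => /orP[/eqP -> _|cx]; first by rewrite addKn.
rewrite leq_eqVlt => /orP[/eqP ->|cy]; first by rewrite addnK.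
have lt_sc : (s c < s c.+1)%N := enum_lt es (ltnSn c) cltn.
have Sw : S (2 * s c.+1 - s c)%N.
  case: (ltnP c.+1 (num_small S)) => h; first exact: st.
  (* The last step, from [s_n], lands above [s_n], where [S] has no gaps. *)
  have <- : num_small S = c.+1 by lia.
  apply: (enum_conductor es); have -> : num_small S = c.+1 by lia.
  lia.
have x1 := enum_next_le es cltn Sx cx.
have y1 := enum_next_le es cltn Sy cy.
have kE1 : (k + c.+1 = num_small S)%N by lia.
have Sxy := IH _ cltn kE1 _ _ Sx Sy x1 y1.
have := IH _ cltn kE1 _ _ Sxy Sw.
have -> : (x + y - s c.+1 + (2 * s c.+1 - s c) - s c.+1 = x + y - s c)%N by lia.
by apply; lia.
Qed.

(** The step from [s_m] to [s_(m+1)] is the Arf condition for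
    [x = y = s_(m+1)] and [z = s_m]; closure of all the [S_c] under addition
    gives back the general condition by taking [s_c = z]. *)
Lemma A_semigroup_stepP (S : set nat) (s : nat -> nat) :
  numerical_semigroup S -> enumerates S s ->
  A_semigroup S <-> step_closed S s.
Proof.
move=> nS es; split=> [[_ arf] m mn|st].
  rewrite mul2n -addnn; apply: arf => //; try by apply: (enum_mem es); lia.
  exact: ltnW (enum_lt es (ltnSn m) (ltnW mn)).
split=> // x y z Sx Sy Sz zy yx.
have [[c cn zE]|nz] := enum_cases es Sz; last by apply: (enum_conductor es); lia.
by rewrite zE in zy *; apply: (step_closed_add es st cn) => //; exact: leq_trans zy yx.
Qed.

(** * The sequence of differences *)

Definition gaps (s : nat -> nat) (n : nat) : seq int :=
  [seq (s (n - i)%N)%:Z - (s (n - i.+1)%N)%:Z | i <- iota 0 n].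

Lemma size_gaps (s : nat -> nat) (n : nat) : size (gaps s n) = n.
Proof. by rewrite size_map size_iota. Qed.

Lemma nth_gaps (s : nat -> nat) (n i : nat) : (i < n)%N ->
  (gaps s n)`_i = (s (n - i)%N)%:Z - (s (n - i.+1)%N)%:Z.
Proof. by move=> iln; rewrite (nth_map 0%N) ?size_iota // nth_iota. Qed.

Lemma sum_gaps (s : nat -> nat) (n j i : nat) : (j <= i)%N -> (i <= n)%N ->
  \sum_(j <= k < i) (gaps s n)`_k = (s (n - j)%N)%:Z - (s (n - i)%N)%:Z.
Proof.
move=> ji iln; rewrite -[RHS]opprK opprB -(telescope_sumr (fun k => (s (n - k)%N)%:Z)) //.
rewrite -sumrN; apply: eq_big_nat => k /andP[_ ki].
by rewrite nth_gaps ?opprB //; apply: leq_trans iln.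
Qed.

(** The least element of [S] above [s_(m+1)] is [s_(m+2)], so closure under the
    steps yields the monotonicity of the differences as well as the sums. *)
Lemma A_sequence_gapsP (S : set nat) (s : nat -> nat) :
  numerical_semigroup S -> S <> setT -> enumerates S s ->
  A_sequence (gaps s (num_small S)) <-> step_closed S s.
Proof.
move=> nS SN es; set n := num_small S.
rewrite /A_sequence size_gaps; split=> [[_ _ _ sums] m mn|st].
  have il : ((n - m.+2).+1 < n)%N by rewrite -/n in mn; lia.
  have lt_sm : (s m < s m.+1)%N := enum_lt es (ltnSn m) (ltnW mn).
  have := sums _ il; rewrite nth_gaps //.
  have m1E : (n - (n - m.+2).+1 = m.+1)%N by rewrite -/n in mn; lia.
  have m0E : (n - (n - m.+2).+2 = m)%N by rewrite -/n in mn; lia.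
  rewrite m1E m0E.
  case=> [[j ji]|]; rewrite sum_gaps ?m1E ?subn0; try lia.
    move=> e; have -> : (2 * s m.+1 - s m = s (n - j))%N by lia.
    by apply: (enum_mem es); rewrite leq_subr.
  by move=> e; apply: (enum_conductor es); rewrite -/n; lia.
have n0 : (0 < n)%N := num_small_gt0 es.
split=> //.
- have [SF _] := frobenius_numberP nS SN.
  rewrite nth_gaps // subn0 subn1.
  have Sp : S (s n.-1) by apply: (enum_mem es); exact: leq_pred.
  have pn : (s n.-1 < s n)%N by apply: (enum_lt es); rewrite ?prednK.
  have sn : s n = (frobenius_number S).+1 by case: es.
  have neF : s n.-1 <> frobenius_number S by move=> e; rewrite e in Sp.
  lia.
- move=> i il; rewrite !nth_gaps ?(ltnW il) //.
  have [m mE] : exists m, (m.+2 + i = n)%N by exists (n - i.+2)%N; lia.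
  have m2E : (n - i = m.+2)%N by lia.
  have m1E : (n - i.+1 = m.+1)%N by lia.
  have m0E : (n - i.+2 = m)%N by lia.
  rewrite m2E m1E m0E.
  have mn : (m.+1 < num_small S)%N by rewrite -/n; lia.
  have lt_sm : (s m < s m.+1)%N := enum_lt es (ltnSn m) (ltnW mn).
  by have := enum_next_le es mn (st _ mn); lia.
- move=> i il; rewrite nth_gaps //.
  have [m mE] : exists m, (m.+2 + i = n)%N by exists (n - i.+2)%N; lia.
  have m1E : (n - i.+1 = m.+1)%N by lia.
  have m0E : (n - i.+2 = m)%N by lia.
  have mn : (m.+1 < num_small S)%N by rewrite -/n; lia.
  have lt_sm : (s m < s m.+1)%N := enum_lt es (ltnSn m) (ltnW mn).
  have w_gt : (s m.+1 < 2 * s m.+1 - s m)%N by lia.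
  have [[p /andP[mp pn] e]|e] := enum_above es mn (st _ mn) w_gt.
    (* The summands from index [n - p] on add up to [s_p - s_(m+1)]. *)
    rewrite -/n in pn; left; exists (n - p)%N; first lia.
    rewrite sum_gaps; [|lia..].
    by rewrite subKn // m1E m0E; lia.
  by right; rewrite sum_gaps ?(ltnW il) // subn0 m1E m0E; rewrite -/n in e; lia.
Qed.

Theorem corollary5p2 (S : set nat) (s : nat -> nat) :
  numerical_semigroup S -> S <> setT -> enumerates S s ->
  A_semigroup S <->
  A_sequence [seq (s (num_small S - i)%N)%:Z - (s (num_small S - i.+1)%N)%:Z
             | i <- iota 0 (num_small S)].
Proof.
move=> nS SN es; rewrite -/(gaps s (num_small S)).
have arfP := A_semigroup_stepP nS es; have seqP := A_sequence_gapsP nS SN es.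
by split=> [/arfP/seqP|/seqP/arfP].
Qed.
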